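(* Let $n\ge 1$, $m\ge 2$ and $0\le k\le n-1$, and let $\mathcal{C}^k_{ac}$ be the class of all complete acyclic $k$-bounded CP-nets over $n$ variables of domain size $m$, over the instance space $\mathcal{X}_{swap}$. Then \[n(m-1)m^k\le n(m-1)\mathcal{U}_k\le \mathrm{TD}(\mathcal{C}^k_{ac})\le e_{max}+n(m-1)\mathcal{U}_k\le nk+n(m-1)\binom{n-1}{k}m^k.\] Moreover, $\mathrm{TD}(\mathcal{C}^0_{ac})=(m-1)n$, $\mathrm{TD}(\mathcal{C}^1_{ac})=(m-1)mn$, and $\mathrm{TD}(\mathcal{C}^{n-1}_{ac})=(m-1)nm^{n-1}$.
   Context: Variables $V=\{v_1,\dots,v_n\}$, each with a finite domain of size $m$. An outcome assigns a value to every variable; $\mathcal{O}_X$ denotes assignments to $X\subseteq V$. A CP-net specifies for each $v_i$ a parent set $Pa(v_i)\subseteq V\setminus\{v_i\}$ and, for each context $\gamma\in\mathcal{O}_{Pa(v_i)}$, either a strict total order $\succ^{v_i}_\gamma$ on $D_{v_i}$ or nothing; complete means an order is given for every variable and context; parents are non-dummy (each parent actually affects the preferences). Acyclic: the graph with edges $(v_j,v_i)$, $v_j\in Pa(v_i)$, is acyclic; $k$-bounded: all $|Pa(v_i)|\le k$. Improving flip: changing only $v_i$ to a value preferred under $\succ^{v_i}_{o[Pa(v_i)]}$; $o'\succ o$ iff a nonempty sequence of improving flips leads from $o$ to $o'$. A swap is an ordered pair $x=(x.1,x.2)$ of outcomes differing in exactly one variable; $\mathcal{X}_{swap}$ contains,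 for each unordered such pair, exactly one of its two orderings (fixed arbitrarily); a CP-net $N$ is the concept $c_N(x)=1$ iff $x.1\succ x.2$. A teaching set for $c$ in class $\mathcal{C}$ is a set of labeled examples consistent with $c$ and with no other concept of $\mathcal{C}$; $\mathrm{TD}(c,\mathcal{C})$ is the minimum size of one and $\mathrm{TD}(\mathcal{C})=\max_{c\in\mathcal{C}}\mathrm{TD}(c,\mathcal{C})$. $e_{max}=(n-k)k+\binom{k}{2}$. A set $S\subseteq\{1,\dots,m\}^{n-1}$ is $(m,n-1,k)$-universal if for every set of $k$ coordinates, the projection of $S$ onto these coordinates contains all $m^k$ vectors; $\mathcal{U}_k$ is the smallest size of an $(m,n-1,k)$-universal set. *)

(* Defs.v *)
From mathcomp Require Import all_boot all_fingroup.
Set Implicit Arguments. Unset Strict Implicit. Unset Printing Implicit Defensive.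

Definition outcome (n m : nat) := {ffun 'I_n -> 'I_m}.

(* A CP-net: parent sets and, for each variable i, a conditional preference
   table mapping an outcome (only its restriction to Pa(i) matters, see
   [cpt_local]) to a strict total order on 'I_m, encoded by a permutation
   [p] (a value a is preferred to b iff p a > p b).  Giving an order for every
   context makes the CP-net complete by construction. *)
Definition cpnet (n m : nat) :=
  ({ffun 'I_n -> {set 'I_n}} * {ffun 'I_n -> {ffun outcome n m -> {perm 'I_m}}})%type.

Definition pa n m (N : cpnet n m) (i : 'I_n) : {set 'I_n} := N.1 i.
Definition cpt n m (N : cpnet n m) (i : 'I_n) (o : outcome n m) : {perm 'I_m} := N.2 i o.

Definition pref m (p : {perm 'I_m}) (a b : 'I_m) : bool := p b < p a.

Definition cpt_local n m (N : cpnet n m) : bool :=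
  [forall i, forall o : outcome n m, forall o' : outcome n m,
     [forall j in pa N i, o j == o' j] ==> (cpt N i o == cpt N i o')].

Definition pa_irrefl n m (N : cpnet n m) : bool := [forall i, i \notin pa N i].

Definition nondummy n m (N : cpnet n m) : bool :=
  [forall i, forall j in pa N i, exists o : outcome n m, exists o' : outcome n m,
     [forall l, (l != j) ==> (o l == o' l)] && (cpt N i o != cpt N i o')].

Definition dep_edge n m (N : cpnet n m) : rel 'I_n := fun j i => j \in pa N i.

Definition acyclic n m (N : cpnet n m) : bool :=
  [forall i, ~~ [exists j, dep_edge N i j && connect (dep_edge N) j i]].

Definition kbounded n m (k : nat) (N : cpnet n m) : bool :=
  [forall i, #|pa N i| <= k].

Definition valid_ac n m (k : nat) (N : cpnet n m) : bool :=
  [&& cpt_local N, pa_irrefl N, nondummy N, acyclic N & kbounded k N].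

Definition improving_flip n m (N : cpnet n m) : rel (outcome n m) :=
  fun o o' => [exists i, [forall j, (j != i) ==> (o j == o' j)]
                         && pref (cpt N i o) (o' i) (o i)].

Definition dominates n m (N : cpnet n m) (o' o : outcome n m) : bool :=
  [exists o1, improving_flip N o o1 && connect (improving_flip N) o1 o'].

Definition instance n m := (outcome n m * outcome n m)%type.

Definition is_swap n m (x : instance n m) : bool :=
  #|[set i | x.1 i != x.2 i]| == 1.

Definition swap_space n m (S : {set instance n m}) : bool :=
  [forall x in S, is_swap x] &&
  [forall o : outcome n m, forall o' : outcome n m,
     is_swap (o, o') ==> (((o, o') \in S) (+) ((o', o) \in S))].

Definition concept n m (S : {set instance n m}) (N : cpnet n m) : {ffun instance n m -> bool} :=
  [ffun x => (x \in S) && dominates N x.1 x.2].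

Definition Cac n m (k : nat) (S : {set instance n m}) : {set {ffun instance n m -> bool}} :=
  [set concept S N | N in [pred N : cpnet n m | valid_ac k N]].

Definition teaching_set n m (S : {set instance n m}) (C : {set {ffun instance n m -> bool}})
    (c : {ffun instance n m -> bool}) (T : {set instance n m}) : bool :=
  (T \subset S) && [forall c' in C, [forall x in T, c' x == c x] ==> (c' == c)].

(* minimum size of a teaching set (S itself is always one, so the default #|S| is harmless) *)
Definition TDc n m (S : {set instance n m}) (C : {set {ffun instance n m -> bool}})
    (c : {ffun instance n m -> bool}) : nat :=
  \big[minn/#|S|]_(T : {set instance n m} | teaching_set S C c T) #|T|.

Definition TD n m (S : {set instance n m}) (C : {set {ffun instance n m -> bool}}) : nat :=
  \max_(c in C) TDc S C c.

Definition e_max (n k : nat) : nat := (n - k) * k + 'C(k, 2).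

Definition universal (m d k : nat) (U : {set {ffun 'I_d -> 'I_m}}) : bool :=
  [forall K : {set 'I_d}, (#|K| == k) ==>
     [forall v : {ffun 'I_d -> 'I_m}, exists u in U, [forall j in K, u j == v j]]].

(* U_k: smallest size of an (m, n-1, k)-universal set (the full set, of size m^(n-1),
   is universal when k <= n-1) *)
Definition Ucal (m n k : nat) : nat :=
  \big[minn/m ^ n.-1]_(U : {set {ffun 'I_n.-1 -> 'I_m}} | universal k U) #|U|.

(* Main.v *)
Require Import Defs.
From mathcomp Require Import all_boot all_fingroup.
From mathcomp Require Import zify.
Set Implicit Arguments. Unset Strict Implicit. Unset Printing Implicit Defensive.

(** In an acyclic CP-net the label of a swap is read off the preference table of
    the swapped variable, since a weighted sum of local ranks strictly increases
    along improving flips.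

    Lower bound: consider the net without parents in which every variable has
    the natural order.  For a variable [i], two consecutive values [t, t + 1], a
    set of [k] parents of [i] and one context on them, exchanging [t] and [t + 1]
    in that context only gives another net of the class, which is refuted only by
    examples swapping [t] and [t + 1] in [i].  Hence in a teaching set the contexts
    of these examples form a universal set, for each of the [n (m - 1)] pairs
    [(i, t)].

    Upper bound: teach the orders of each variable in the contexts of a universal
    set, plus one example per edge of the net.  The latter force every consistent
    net to contain all true parents, after which universality determines its
    tables.  An acyclic graph with in-degrees at most [k] has at most [e_max]
    edges.  For [k = 1] and [k = n - 1] the contexts can be chosen so that no
    extra example is needed. *)

(** * Minima over a finite type *)

Lemma bigminn_ge (I : finType) (P : pred I) (F : I -> nat) x b :
  b <= x -> (forall i, P i -> b <= F i) -> b <= \big[minn/x]_(i | P i) F i.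
Proof. by move=> bx bF; elim/big_ind: _ => // y z by_ bz; rewrite leq_min by_. Qed.

Lemma bigminn_le (I : finType) (P : pred I) (F : I -> nat) x i :
  P i -> \big[minn/x]_(j | P j) F j <= F i.
Proof.
move=> Pi; have: i \in index_enum I by rewrite mem_index_enum.
elim: (index_enum I) => // j r IHr; rewrite inE big_cons.
case: eqP => [<- _|_ /= /IHr le_r]; first by rewrite Pi geq_minl.
by case: ifP => // _; rewrite geq_min le_r orbT.
Qed.

Lemma bigminn_attained (I : finType) (P : pred I) (F : I -> nat) x i0 :
  P i0 -> F i0 = x -> exists2 i, P i & F i = \big[minn/x]_(j | P j) F j.
Proof.
move=> Pi0 Fi0; elim/big_ind: _ => [|y z [i Pi <-] [j Pj <-]|i Pi].
- by exists i0.
- by case: (leqP (F i) (F j)) => _; [exists i | exists j].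
- by exists i.
Qed.

(** * Permutations as linear orders *)

Lemma pref_asym m (p : {perm 'I_m}) a b :
  a != b -> pref p b a = ~~ pref p a b.
Proof.
move=> ab; rewrite /pref; have : p a != p b :> nat.
  by apply: contraNneq ab => E; apply/eqP/(@perm_inj _ p)/val_inj.
by lia.
Qed.

Lemma increasing_perm1 m (s : {perm 'I_m}) :
  (forall t t' : 'I_m, t' = t.+1 :> nat -> s t < s t') -> s = 1%g.
Proof.
move=> incr.
have mono d : forall t t' : 'I_m, t' = t + d :> nat -> s t + d <= s t'.
  elim: d => [|d IHd] t t' t'E.
    by rewrite addn0 (_ : t = t') //; apply: val_inj; rewrite /= t'E addn0.
  have lt_td : t + d < m by have := ltn_ord t'; lia.
  have := IHd t (Ordinal lt_td) erefl.
  have := incr (Ordinal lt_td) t' ltac:(rewrite /= t'E addnS //).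
  lia.
apply/permP => t; rewrite perm1; apply: val_inj => /=.
have m_gt0 : 0 < m by have := ltn_ord t; lia.
have lt_m1 : m.-1 < m by lia.
(* Growth from [0] up to [t] gives [t <= s t]; growth from [t] up to [m - 1] leaves room only for
   [s t <= t]. *)
have := mono t (Ordinal m_gt0) t ltac:(by []).
have := mono (m.-1 - t) t (Ordinal lt_m1) ltac:(by have := ltn_ord t; rewrite /=; lia).
have := ltn_ord (s (Ordinal lt_m1)); have := ltn_ord t; lia.
Qed.

(** The value of rank [t] under [p] is [p^-1 t], so the hypothesis makes [p^-1 * q] increase on
    consecutive ranks, hence the identity. Thus [m - 1] comparisons pin down an order. *)
Lemma eq_perm_consecutive m (p q : {perm 'I_m}) :
  (forall t t' : 'I_m, t' = t.+1 :> nat -> pref q ((p^-1)%g t') ((p^-1)%g t)) ->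
  q = p.
Proof.
move=> incr; apply/esym/(mulgI (p^-1)%g); rewrite mulVg; apply/esym.
by apply: increasing_perm1 => t t' tt'; rewrite !permM; apply: incr.
Qed.

Lemma perm_neq_pref m (p q : {perm 'I_m}) : q != p ->
  exists a b, [/\ a != b, pref p a b & ~~ pref q a b].
Proof.
move=> neq_qp.
have [t [t' [tt' Npref]]]: exists t t' : 'I_m,
    t' = t.+1 :> nat /\ ~~ pref q ((p^-1)%g t') ((p^-1)%g t).
  case: (boolP [exists t : 'I_m, exists t' : 'I_m,
      (t' == t.+1 :> nat) && ~~ pref q ((p^-1)%g t') ((p^-1)%g t)]).
    by case/existsP=> t /existsP[t' /andP[/eqP tt' Nq]]; exists t, t'.
  move=> /existsPn all_pref; case/eqP: neq_qp; apply: eq_perm_consecutive.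
  move=> t t' tt'; have /existsPn/(_ t') := all_pref t.
  by rewrite tt' eqxx negbK.
exists ((p^-1)%g t'), ((p^-1)%g t); split=> //; last by rewrite /pref !permKV tt'.
by apply/eqP=> /perm_inj E; move: tt'; rewrite E; lia.
Qed.

(** * Swaps in acyclic CP-nets *)

Definition upd n m (o : outcome n m) (i : 'I_n) (a : 'I_m) : outcome n m :=
  [ffun j => if j == i then a else o j].

Lemma updE n m (o : outcome n m) i a : upd o i a i = a.
Proof. by rewrite ffunE eqxx. Qed.

Lemma upd_neq n m (o : outcome n m) i a j : j != i -> upd o i a j = o j.
Proof. by rewrite ffunE => /negPf->. Qed.

Lemma eq_cpt n m (N : cpnet n m) i (o o' : outcome n m) :
  cpt_local N -> {in pa N i, o =1 o'} -> cpt N i o = cpt N i o'.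
Proof.
move=> /forallP/(_ i)/forallP/(_ o)/forallP/(_ o')/implyP locN eq_oo'.
by apply/eqP/locN/forall_inP => j /eq_oo'->.
Qed.

Lemma cpt_upd n m k (N : cpnet n m) i (o : outcome n m) a :
  valid_ac k N -> cpt N i (upd o i a) = cpt N i o.
Proof.
case/and5P=> locN /forallP/(_ i) iNpa _ _ _; apply: eq_cpt => // j paj.
by rewrite upd_neq //; apply: contraTneq paj => ->.
Qed.

(** Whatever [j] reaches, [i] reaches, while acyclicity keeps [i] itself out of reach of [j]. The
    number of descendants thus ranks the variables, both in the weights and in the edge count. *)
Lemma acyclic_card_connect n m (N : cpnet n m) i j : acyclic N -> dep_edge N i j ->
  #|[set l | connect (dep_edge N) j l]| < #|[set l | connect (dep_edge N) i l]|.
Proof.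
move=> /forallP/(_ i)/existsPn/(_ j); rewrite negb_and => cycN eij.
rewrite eij /= in cycN; apply: proper_card; apply/properP; split.
  by apply/subsetP=> l; rewrite !inE; apply: connect_trans; apply: connect1.
by exists i; rewrite inE ?connect0.
Qed.

Lemma rank_acyclic n m (N : cpnet n m) (r : 'I_n -> nat) :
  (forall i j, dep_edge N i j -> r i < r j) -> acyclic N.
Proof.
move=> rN; apply/forallP => i; apply/existsP => -[j /andP[/rN]].
suff le_r x y : connect (dep_edge N) x y -> r x <= r y by move=> rij /le_r; lia.
case/connectP=> p; elim: p x => [x _ -> //|z p IHp x /= /andP[/rN xz pz] /IHp].
by move/(_ pz); lia.
Qed.

(* Each variable weighs more than [m] times all its children together, so
   improving the value of a variable outweighs any loss in its children. *)
Definition weight n m (N : cpnet n m) (i : 'I_n) : nat :=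
  (n * m) ^ #|[set l | connect (dep_edge N) i l]|.

Definition potential n m (N : cpnet n m) (o : outcome n m) : nat :=
  \sum_i weight N i * cpt N i o (o i).

Lemma potential_flip n m k (N : cpnet n m) (o o' : outcome n m) : valid_ac k N ->
  improving_flip N o o' -> potential N o < potential N o'.
Proof.
move=> valN /existsP[i /andP[/forallP eq_oo' prefN]].
have {}eq_oo' j : j != i -> o j = o' j by move/(implyP (eq_oo' j))/eqP.
have oE : o' = upd o i (o' i).
  by apply/ffunP=> j; rewrite ffunE; case: eqVneq => [->|/eq_oo'].
have {}prefN : cpt N i o (o i) < cpt N i o' (o' i).
  by rewrite [in cpt N i o']oE (cpt_upd _ _ _ valN).
have /and5P[locN irrN _ acN _] := valN.
rewrite /potential (bigD1 i) //= [ltnRHS](bigD1 i) //=.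
set W := weight N.
(* A variable that is not a child of [i] keeps its term; a child loses at most [W j * m], ranks
   being below [m]. *)
have step j : j != i -> W j * cpt N j o (o j)
    <= W j * cpt N j o' (o' j) + (if i \in pa N j then W j * m else 0).
  move=> ji; case: ifP => paij.
    by apply: leq_trans (leq_addl _ _); rewrite leq_mul2l ltnW ?orbT // ltn_ord.
  rewrite addn0 (eq_oo' j ji) (eq_cpt (o' := o') locN) // => l pal.
  by apply: eq_oo'; apply: contraFneq paij => <-.
(* With [h] descendants of [i], a child has at most [h - 1]; at most [n - 1] children cost
   [(n - 1) * m * (n * m) ^ (h - 1)], which is less than [(n * m) ^ h]. *)
have sumW : \sum_(j | j != i) (if i \in pa N j then W j * m else 0) < W i.
  have n0 : 0 < n by have := ltn_ord i; lia.
  have m0 : 0 < m by have := ltn_ord (o i); lia.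
  have h0 : 0 < #|[set l | connect (dep_edge N) i l]|.
    by rewrite card_gt0; apply/set0Pn; exists i; rewrite inE connect0.
  apply: (@leq_ltn_trans (\sum_(j | j != i)
      (n * m) ^ #|[set l | connect (dep_edge N) i l]|.-1 * m)).
    apply: leq_sum => j ji; case: ifP => // paij.
    rewrite leq_mul2r leq_pexp2l ?orbT ?muln_gt0 ?n0 //.
    by have := acyclic_card_connect acN (paij : dep_edge N i j); lia.
  rewrite sum_nat_const /W /weight -{2}(prednK h0) expnS.
  have -> : #|[pred j | j != i]| = n.-1 by rewrite -[in n.-1](card_ord n) (cardC1 i).
  rewrite [_ ^ _ * m]mulnC mulnA ltn_mul2r expn_gt0 muln_gt0 n0 m0 /=.
  by rewrite ltn_mul2r m0 /=; lia.
have : \sum_(j | j != i) W j * cpt N j o (o j) <=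
    \sum_(j | j != i) W j * cpt N j o' (o' j)
    + \sum_(j | j != i) (if i \in pa N j then W j * m else 0).
  by rewrite -big_split; apply: leq_sum => j /step.
have : W i * (cpt N i o (o i)).+1 <= W i * cpt N i o' (o' i).
  by rewrite leq_mul2l prefN orbT.
rewrite mulnS => le_i le_others.
apply: leq_ltn_trans (leq_add (leqnn _) le_others) _.
rewrite addnCA [ltnRHS]addnC ltn_add2l; apply: leq_trans le_i.
by rewrite addnC ltn_add2r.
Qed.

(** A preferred value is reached by one flip. Dominance against the preference would close a cycle
    of improving flips, along which the potential cannot keep growing. *)
Lemma dominates_upd n m k (N : cpnet n m) i (o : outcome n m) a b : valid_ac k N ->
  a != b -> dominates N (upd o i a) (upd o i b) = pref (cpt N i o) a b.
Proof.
move=> valN ab.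
have flip c d : pref (cpt N i o) d c -> improving_flip N (upd o i c) (upd o i d).
  move=> pdc; apply/existsP; exists i; rewrite !updE (cpt_upd _ _ _ valN) pdc andbT.
  by apply/forallP => j; apply/implyP => ji; rewrite !upd_neq.
apply/idP/idP => [|/flip fl]; last by apply/existsP; exists (upd o i a); rewrite fl connect0.
case/existsP=> o1 /andP[/(potential_flip valN) lt1 con].
rewrite -[pref _ _ _]negbK -pref_asym //; apply/negP => /flip/(potential_flip valN).
suff : potential N o1 <= potential N (upd o i a) by lia.
case/connectP: con => p; elim: p (o1) {lt1} => [x _ -> //|y p IHp x /=].
by case/andP=> /(potential_flip valN) xy pp /(IHp _ pp); lia.
Qed.

(** Induction on a set [A] of variables: a member with fewest descendants has no child in [A], so
    removing it loses only its own incoming edges, at most [minn (#|A| - 1) k]. *)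
Lemma card_edges_le n m k (N : cpnet n m) : valid_ac k N -> k <= n ->
  \sum_i #|pa N i| <= e_max n k.
Proof.
case/and5P=> _ /forallP irrN _ acN /forallP bndN le_kn.
have sub a (A : {set 'I_n}) : #|A| = a ->
    \sum_(i in A) #|pa N i :&: A| <= \sum_(0 <= t < a) minn t k.
  elim: a A => [|a IHa] A cA.
    by rewrite (cards0_eq cA) big_set0.
  have /card_gt0P[x0 Ax0] : 0 < #|A| by rewrite cA.
  case: (@arg_minnP _ x0 (mem A) (fun i => #|[set l | connect (dep_edge N) i l]|) Ax0)
    => x Ax' minx; have Ax : x \in A := Ax'.
  have cAx : #|A :\ x| = a by move: cA; rewrite (cardsD1 x) Ax => -[].
  rewrite big_nat_recr //= (bigD1 x) //= addnC; apply: leq_add; last first.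
    rewrite leq_min; apply/andP; split.
      rewrite -cAx; apply/subset_leq_card/subsetP => j; rewrite !inE => /andP[paj ->].
      by rewrite andbT; apply: contraTneq paj => ->.
    by apply: leq_trans (bndN x); apply: subset_leq_card; apply: subsetIl.
  apply: leq_trans (IHa _ cAx).
  rewrite [leqLHS](eq_bigl (fun i => i \in A :\ x)); last by move=> i; rewrite !inE andbC.
  apply: leq_sum => i; rewrite !inE => /andP[ix Ai].
  apply/subset_leq_card/subsetP => j; rewrite !inE => /andP[paj ->]; rewrite paj andbT /=.
  apply: contraTneq paj => ->; apply/negP => e_xi.
  by have := minx i Ai; have := acyclic_card_connect acN (e_xi : dep_edge N x i); lia.
(* The terms below [k] add up to ['C(k, 2)], the other [n - k] terms are [k]. *)
have -> : e_max n k = \sum_(0 <= t < n) minn t k.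
  rewrite (big_cat_nat (leq0n k) le_kn) /= (eq_big_nat _ _ (F2 := id)); last by move=> t; lia.
  rewrite (eq_big_nat _ _ (m := k) (F2 := fun=> k)); last by move=> t; lia.
  by rewrite sum_nat_const_nat /e_max bin2_sum addnC.
have := sub n setT; rewrite cardsT card_ord => /(_ erefl); congr (_ <= _).
by apply: eq_big => [i|i _]; rewrite ?inE ?setIT.
Qed.

Lemma leq_card_bigcup (I T : finType) (P : pred I) (F : I -> {set T}) :
  #|\bigcup_(i | P i) F i| <= \sum_(i | P i) #|F i|.
Proof.
elim/big_rec2: _ => [|i A a _ le_Aa]; first by rewrite cards0.
by apply: leq_trans (leq_card_setU _ _) _; rewrite leq_add.
Qed.

(** * Universal sets *)

(** The default value of the minimum is the size of the full set, which is universal. *)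
Lemma Ucal_attained m n k :
  exists2 U : {set {ffun 'I_n.-1 -> 'I_m}}, universal k U & #|U| = Ucal m n k.
Proof.
apply: (@bigminn_attained _ _ _ _ setT); last by rewrite cardsT card_ffun !card_ord.
apply/forallP => K; apply/implyP => _; apply/forallP => v.
by apply/existsP; exists v; rewrite inE; apply/forall_inP.
Qed.

Lemma Ucal_le m n k (U : {set {ffun 'I_n.-1 -> 'I_m}}) :
  universal k U -> Ucal m n k <= #|U|.
Proof. exact: bigminn_le. Qed.

Lemma universalP m d k (U : {set {ffun 'I_d -> 'I_m}}) :
  reflect (forall K : {set 'I_d}, #|K| = k -> forall v : {ffun 'I_d -> 'I_m},
             exists2 u : {ffun 'I_d -> 'I_m}, u \in U & {in K, u =1 v})
          (universal k U).
Proof.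
apply: (iffP forallP) => [uU K cK v|uU K].
  have /implyP/(_ (introT eqP cK))/forallP/(_ v)/existsP[u /andP[Uu /forall_inP uv]] := uU K.
  by exists u => // j /uv/eqP.
apply/implyP=> /eqP cK; apply/forallP => v; have [u Uu uv] := uU K cK v.
by apply/existsP; exists u; rewrite Uu; apply/forall_inP => j /uv->.
Qed.

Lemma exists_set_card d k (A : {set 'I_d}) : #|A| <= k -> k <= d ->
  exists2 K : {set 'I_d}, #|K| = k & A \subset K.
Proof.
move=> leAk le_kd; have [j] := ubnP (k - #|A|); elim: j A leAk => // j IHj A leAk lt_j.
have [<-|neq] := eqVneq #|A| k; first by exists A.
have /subsetPn[x _ xA]: ~~ ([set: 'I_d] \subset A).
  by apply: contra neq => /subset_leq_card; rewrite cardsT card_ord; lia.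
have lt_Ak : #|A| < k by rewrite ltn_neqAle neq.
have cAx : #|x |: A| = #|A|.+1 by rewrite cardsU1 xA.
have [||K cK subK] := IHj (x |: A); rewrite ?cAx //.
  by rewrite subnS; move: lt_j; rewrite -subn_gt0 in lt_Ak; case: (k - #|A|) lt_Ak.
by exists K => //; apply: subset_trans subK; apply: subsetUr.
Qed.

(** Resetting all coordinates outside a fixed [K] of size [k] to [z] maps [U] onto the [m ^ k]
    vectors supported in [K]. *)
Lemma leq_Ucal m n k : 0 < m -> k <= n.-1 -> m ^ k <= Ucal m n k.
Proof.
move=> m_gt0 le_kn; have [U /universalP uU <-] := Ucal_attained m n k.
have [K cK _] := @exists_set_card n.-1 k set0 ltac:(by rewrite cards0) le_kn.
pose z : 'I_m := Ordinal m_gt0.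
have -> : m ^ k = #|pffun_on z (mem K) (mem 'I_m)|.
  by rewrite card_pffun_on card_ord cK.
pose r (u : {ffun 'I_n.-1 -> 'I_m}) : {ffun 'I_n.-1 -> 'I_m} :=
  [ffun j => if j \in K then u j else z].
apply: leq_trans (leq_imset_card r U); apply/subset_leq_card/subsetP => v.
case/pffun_onP => supp_v _; have [u Uu uv] := uU K cK v.
apply/imsetP; exists u => //; apply/ffunP => j; rewrite ffunE.
case: ifPn => [/uv-> //|jK]; apply/eqP; apply: contraNT jK => vj.
exact: (subsetP supp_v).
Qed.

(** All vectors that equal [z] outside some set of [k] coordinates form a universal set. *)
Lemma Ucal_leq m n k : 0 < m -> Ucal m n k <= 'C(n.-1, k) * m ^ k.
Proof.
move=> m_gt0; pose z : 'I_m := Ordinal m_gt0.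
pose U := \bigcup_(K : {set 'I_n.-1} | #|K| == k) [set v in pffun_on z (mem K) predT].
have uU : universal k U.
  apply/universalP => K cK v; exists [ffun j => if j \in K then v j else z].
    apply/bigcupP; exists K; first exact/eqP.
    rewrite inE; apply/pffun_onP; split=> //.
    by apply/subsetP => j; rewrite inE ffunE; case: ifP => //; rewrite eqxx.
  by move=> j Kj; rewrite ffunE Kj.
apply: leq_trans (Ucal_le uU) _.
apply: (@leq_trans (\sum_(K : {set 'I_n.-1} | #|K| == k) m ^ k)).
  apply: leq_trans (leq_card_bigcup _ _) _; apply: leq_sum => K /eqP <-.
  by rewrite cardsE card_pffun_on (eq_card (B := 'I_m)) // card_ord.
by rewrite sum_nat_const -[X in 'C(X, _)](card_ord n.-1) -card_draws cardsE.
Qed.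

(** * Examples and teaching sets *)

Lemma swap_uniq n m (x : instance n m) i j :
  is_swap x -> x.1 i != x.2 i -> x.1 j != x.2 j -> i = j.
Proof.
move=> /cards1P[l xE] xi xj.
have : i \in [set i | x.1 i != x.2 i] by rewrite inE.
have : j \in [set i | x.1 i != x.2 i] by rewrite inE.
by rewrite xE !inE => /eqP-> /eqP->.
Qed.

Lemma swap_upd n m (x : instance n m) : is_swap x ->
  exists2 i, x.1 i != x.2 i & x = (upd x.1 i (x.1 i), upd x.1 i (x.2 i)).
Proof.
move=> swx; have /cards1P[i xE] := swx.
have xi : x.1 i != x.2 i by have := set11 i; rewrite -xE inE.
exists i => //; case: x swx xi {xE} => o o' /= swx oi.
congr (_, _); apply/ffunP => j; rewrite ffunE; first by case: eqP => [->|].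
case: eqVneq => [->//|ji]; apply/eqP; apply: contraNT ji => oj.
by apply/eqP/(swap_uniq swx) => //=; rewrite eq_sym.
Qed.

Lemma is_swap_upd n m (o : outcome n m) i a b :
  a != b -> is_swap (upd o i a, upd o i b).
Proof.
move=> ab; apply/cards1P; exists i; apply/setP => j; rewrite !inE /= !ffunE.
by case: (eqVneq j i); rewrite ?ab ?eqxx.
Qed.

(** [S] keeps an arbitrary orientation of each swap, so the comparison of [a] and [b] for [i] in
    context [o] is asked through whichever one is present. *)
Definition oriented_swap n m (S : {set instance n m})
    (q : 'I_n * outcome n m * ('I_m * 'I_m)) : instance n m :=
  let: (i, o, (a, b)) := q in
  if (upd o i a, upd o i b) \in S then (upd o i a, upd o i b)
  else (upd o i b, upd o i a).

Lemma oriented_swap_in n m (S : {set instance n m}) q :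
  swap_space S -> q.2.1 != q.2.2 -> oriented_swap S q \in S.
Proof.
case: q => [[i o] [a b]] /= /andP[_ /forallP ornt] ab.
have /forallP/(_ (upd o i b))/implyP/(_ (is_swap_upd _ _ ab)) := ornt (upd o i a).
by case: ifP.
Qed.

(** Reversing a swap negates its label, the order being total; hence the label reveals the
    preference in either orientation. *)
Lemma concept_oriented_swap n m k (S : {set instance n m}) (N : cpnet n m) i o a b :
  swap_space S -> valid_ac k N -> a != b ->
  concept S N (oriented_swap S (i, o, (a, b))) =
    (((upd o i a, upd o i b) \in S) == pref (cpt N i o) a b).
Proof.
move=> spS valN ab.
have := @oriented_swap_in n m S (i, o, (a, b)) spS ab; rewrite ffunE => -> /=.
case: ifP => _ /=; first by rewrite (dominates_upd _ _ valN ab).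
by rewrite (dominates_upd _ _ valN) 1?eq_sym // pref_asym.
Qed.

Lemma concept_swap n m k (S : {set instance n m}) (N : cpnet n m) x i :
  swap_space S -> valid_ac k N -> x \in S -> x.1 i != x.2 i ->
  concept S N x = pref (cpt N i x.1) (x.1 i) (x.2 i).
Proof.
move=> /andP[/forall_inP swS _] valN Sx xi; rewrite ffunE Sx /=.
have [j xj xE] := swap_upd (swS x Sx).
rewrite (swap_uniq (swS x Sx) xi xj) -(dominates_upd _ _ valN xj).
by rewrite {1 2}xE.
Qed.

Lemma eq_concept n m (S : {set instance n m}) (N N' : cpnet n m) :
  (forall i o, cpt N i o = cpt N' i o) -> concept S N = concept S N'.
Proof.
move=> eq_cptN; have eqN : N.2 = N'.2.
  by apply/ffunP => i; apply/ffunP => o; apply: eq_cptN.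
by apply/ffunP => x; rewrite !ffunE /dominates /improving_flip /cpt eqN.
Qed.

Definition lo m (t : 'I_m.-1) : 'I_m := widen_ord (leq_pred m) t.

Lemma hi_subproof m (t : 'I_m.-1) : t.+1 < m.
Proof. by have := ltn_ord t; lia. Qed.

Definition hi m (t : 'I_m.-1) : 'I_m := Ordinal (hi_subproof t).

(* Any [c] contexts per variable cost [n (m - 1) c] examples, because the order in
   a context is pinned down by its [m - 1] pairs of consecutive values. *)
Lemma TDc_le n m k (S : {set instance n m}) (N : cpnet n m)
    (A : 'I_n -> {set outcome n m}) (E : {set 'I_n * outcome n m * ('I_m * 'I_m)}) c :
  swap_space S -> valid_ac k N -> (forall i, #|A i| <= c) ->
  (forall q, q \in E -> q.2.1 != q.2.2) ->
  (forall N', valid_ac k N' ->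
     (forall i o, o \in A i -> cpt N' i o = cpt N i o) ->
     (forall i o a b, (i, o, (a, b)) \in E ->
        pref (cpt N' i o) a b = pref (cpt N i o) a b) ->
     forall i o, cpt N' i o = cpt N i o) ->
  TDc S (Cac k S) (concept S N) <= #|E| + n * (m - 1) * c.
Proof.
move=> spS valN leAc neqE determined.
(* The question compares the two values that [N] ranks [t + 1] and [t] in the given context. *)
pose g i (e : outcome n m * 'I_m.-1) :=
  (i, e.1, (((cpt N i e.1)^-1)%g (hi e.2), ((cpt N i e.1)^-1)%g (lo e.2))).
pose Q := \bigcup_i (g i @: setX (A i) setT).
have neqQ q : q \in E :|: Q -> q.2.1 != q.2.2.
  rewrite inE => /orP[/neqE // | /bigcupP[i _ /imsetP[[o t] _ ->]] /=].
  by apply/eqP => /perm_inj/(congr1 val)/=; lia.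
have cardQ : #|Q| <= n * (m - 1) * c.
  apply: leq_trans (leq_card_bigcup _ _) _.
  apply: (@leq_trans (\sum_(i < n) (m - 1) * c)); last first.
    by rewrite sum_nat_const card_ord mulnA.
  apply: leq_sum => i _; apply: leq_trans (leq_imset_card _ _) _.
  by rewrite cardsX cardsT card_ord mulnC subn1 leq_mul2l leAc orbT.
apply: (@leq_trans #|oriented_swap S @: (E :|: Q)|); last first.
  apply: leq_trans (leq_imset_card _ _) _; apply: leq_trans (leq_card_setU _ _) _.
  by rewrite leq_add2l.
apply: bigminn_le; apply/andP; split.
  by apply/subsetP => _ /imsetP[q /neqQ neq_q ->]; apply: oriented_swap_in.
apply/forall_inP => _ /imsetP[N' valN' ->]; apply/implyP => /forall_inP agree.
have agreeQ i o a b : (i, o, (a, b)) \in E :|: Q ->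
    pref (cpt N' i o) a b = pref (cpt N i o) a b.
  move=> EQq; have := agree _ (imset_f (oriented_swap S) EQq).
  have ab : a != b := neqQ _ EQq.
  rewrite (concept_oriented_swap i o spS valN ab) (concept_oriented_swap i o spS valN' ab).
  by case: (_ \in S); case: (pref _ _ _); case: (pref _ _ _).
apply/eqP/eq_concept/determined => // [i o Ao|i o a b Eq]; last first.
  by apply: agreeQ; rewrite inE Eq.
apply: eq_perm_consecutive => t t' tt'.
have lt_t : t < m.-1 by have := ltn_ord t'; lia.
pose t0 := Ordinal lt_t.
have -> : t = lo t0 by apply: val_inj.
have -> : t' = hi t0 by apply: val_inj.
rewrite agreeQ /pref ?permKV //= inE; apply/orP; right.
by apply/bigcupP; exists i => //; apply/imsetP; exists (o, t0); rewrite ?inE ?Ao.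
Qed.

(** * Upper bounds *)

Lemma TD_le n m k (S : {set instance n m}) b :
  (forall N, valid_ac k N -> TDc S (Cac k S) (concept S N) <= b) ->
  TD S (Cac k S) <= b.
Proof. by move=> le_b; apply/bigmax_leqP => _ /imsetP[N valN ->]; apply: le_b. Qed.

Lemma card_pa_le n m k (N : cpnet n m) i : valid_ac k N -> #|pa N i| <= k.
Proof. by case/and5P=> _ _ _ _ /forallP. Qed.

Lemma valid_local n m k (N : cpnet n m) : valid_ac k N -> cpt_local N.
Proof. by case/and5P. Qed.

Lemma valid_irrefl n m k (N : cpnet n m) i : valid_ac k N -> i \notin pa N i.
Proof. by case/and5P=> _ /forallP. Qed.

Lemma valid_nondummy n m k (N : cpnet n m) i j : valid_ac k N -> j \in pa N i ->
  exists o o' : outcome n m, (forall l, l != j -> o l = o' l) /\ cpt N i o != cpt N i o'.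
Proof.
case/and5P=> _ _ /forallP/(_ i)/forall_inP nd _ _ /nd.
case/existsP=> o /existsP[o' /andP[/forallP eq_oo' neq]]; exists o, o'; split=> // l.
by move/(implyP (eq_oo' l))/eqP.
Qed.

(** Universal sets live on [n - 1] coordinates. The value [a] filled in at [i] does not affect the
    order of [i], which is not its own parent. *)
Definition extend n m (i : 'I_n) (a : 'I_m) (u : {ffun 'I_n.-1 -> 'I_m}) : outcome n m :=
  [ffun j => if unlift i j is Some j' then u j' else a].

Lemma extend_lift n m (i : 'I_n) (a : 'I_m) u j : extend i a u (lift i j) = u j.
Proof. by rewrite ffunE liftK. Qed.

(** Universality speaks of exactly [k] coordinates, so the preimage of [B] under [lift i] is first
    padded to that size. *)
Lemma universal_extend n m k (U : {set {ffun 'I_n.-1 -> 'I_m}}) i a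
    (B : {set 'I_n}) (o : outcome n m) :
  universal k U -> k <= n.-1 -> #|B| <= k -> i \notin B ->
  exists2 u, u \in U & {in B, extend i a u =1 o}.
Proof.
move=> /universalP uU le_kn leBk iB.
have [|K cK subK] := @exists_set_card n.-1 k [set j | lift i j \in B] _ le_kn.
  apply: leq_trans leBk; rewrite -(card_imset _ (@lift_inj n i)).
  by apply/subset_leq_card/subsetP => _ /imsetP[j + ->]; rewrite inE.
have [u Uu uK] := uU K cK [ffun j => o (lift i j)].
exists u => // l Bl; have : i != l by apply: contraNneq iB => ->.
case/unlift_some => j lE _; rewrite lE extend_lift uK ?ffunE //.
by apply: (subsetP subK); rewrite inE -lE.
Qed.

Lemma TD_le_universal n m k (S : {set instance n m}) : 0 < m -> swap_space S ->
  k <= n.-1 -> TD S (Cac k S) <= e_max n k + n * (m - 1) * Ucal m n k.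
Proof.
move=> m_gt0 spS le_kn; apply: TD_le => N valN.
have [U uU cU] := Ucal_attained m n k.
pose z : 'I_m := Ordinal m_gt0.
pose edges := [set e : 'I_n * 'I_n | e.2 \in pa N e.1].
(* Universality provides a context [u] at which flipping the parent [e.2] alone
   changes the order of [e.1]; the orders at [u] being taught anyway, a single
   example at the flipped context reveals the edge. *)
have /fin_all_exists[q qP] (e : 'I_n * 'I_n) : exists q : 'I_n * outcome n m * ('I_m * 'I_m),
    e \in edges -> [/\ q.1.1 = e.1, q.2.1 != q.2.2 &
      exists u, [/\ u \in U, forall l, l != e.2 -> q.1.2 l = extend e.1 z u l &
        pref (cpt N e.1 q.1.2) q.2.1 q.2.2 !=
          pref (cpt N e.1 (extend e.1 z u)) q.2.1 q.2.2]].
  have [|eN] := boolP (e \in edges); last by exists (e.1, [ffun=> z], (z, z)).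
  case: e => i j; rewrite inE /= => paj.
  have [o [o' [eq_oo' neq]]] := valid_nondummy valN paj.
  have [u Uu uo] := universal_extend z o uU le_kn (card_pa_le i valN) (valid_irrefl i valN).
  pose w := upd (extend i z u) j (o' j).
  have uE : cpt N i (extend i z u) = cpt N i o by apply: eq_cpt (valid_local valN) uo.
  have wE : cpt N i w = cpt N i o'.
    apply: eq_cpt (valid_local valN) _ => l pal; rewrite ffunE.
    by case: eqVneq => [->//|lj]; rewrite uo // eq_oo'.
  have [a [b [ab pa_ Npa]]] := perm_neq_pref neq.
  exists (i, w, (a, b)) => _; split=> //=; exists u; split=> // [l lj|].
    exact: upd_neq.
  by rewrite uE wE pa_ (negPf Npa).
have cE : #|q @: edges| <= e_max n k.
  apply: leq_trans (leq_imset_card _ _) _.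
  apply: leq_trans (card_edges_le valN _); last by lia.
  rewrite -sum1_card; under [leqRHS]eq_bigr do rewrite -sum1_card.
  by rewrite pair_big_dep /=; apply: eq_leq; apply: eq_bigl => e; rewrite inE.
apply: leq_trans (leq_add cE (leqnn _)).
apply: (@TDc_le n m k S N (fun i => extend i z @: U)) => // [i|_ /imsetP[e Ee ->]|].
- by rewrite -cU leq_imset_card.
- by have [] := qP e Ee.
move=> N' valN' eqU eqE i o.
(* Without [j] as a parent, [N'] would have the same order at the flipped context and at [u], but
   the taught preferences there differ. *)
have sub_pa : pa N i \subset pa N' i.
  apply/subsetP => j paj; have Ee : (i, j) \in edges by rewrite inE.
  have := imset_f q Ee; have [] := qP _ Ee.
  case: (q _) => [[_ w] [a b]] /= -> ab [u [Uu wu neq]] /eqE.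
  rewrite -(eqU i (extend i z u)) ?imset_f // in neq => eqw; rewrite -eqw in neq.
  apply: contraNT neq => jN'; rewrite (eq_cpt (o' := extend i z u) (valid_local valN')) //.
  by move=> l pal; apply: wu; apply: contraNneq jN' => <-.
(* Applied to the parents in [N'], which include those in [N], universality gives one taught context
   that agrees with [o] for both nets. *)
have [u Uu uo] := universal_extend z o uU le_kn (card_pa_le i valN') (valid_irrefl i valN').
rewrite -(eq_cpt (valid_local valN') uo) eqU ?imset_f //.
by apply: eq_cpt (valid_local valN) _ => j /(subsetP sub_pa)/uo.
Qed.

Lemma TD_le_full n m k (S : {set instance n m}) : 0 < m -> swap_space S ->
  TD S (Cac k S) <= n * (m - 1) * m ^ n.-1.
Proof.
move=> m_gt0 spS; apply: TD_le => N valN; pose z : 'I_m := Ordinal m_gt0.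
have := @TDc_le n m k S N (fun i => extend i z @: setT) set0 (m ^ n.-1) spS valN.
rewrite cards0; apply=> [i|q|].
- by apply: leq_trans (leq_imset_card _ _) _; rewrite cardsT card_ffun !card_ord.
- by rewrite inE.
move=> N' valN' eqT _ i o; pose o' := extend i z [ffun j => o (lift i j)].
have oE j : j != i -> o j = o' j.
  by rewrite eq_sym => /unlift_some[j' -> _]; rewrite extend_lift ffunE.
have loc N0 : valid_ac k N0 -> cpt N0 i o = cpt N0 i o'.
  move=> valN0; apply: eq_cpt (valid_local valN0) _ => j paj; apply: oE.
  by apply: contraTneq paj => ->; apply: valid_irrefl valN0.
by rewrite !loc // eqT // imset_f.
Qed.

(* For [pa N i = [set j]] the contexts differ in [j] only, so that an order
   change among them reveals the parent; for [pa N i = set0] they are the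
   constant contexts, which form a universal set for [k = 1]. *)
Lemma TD_le_tree n m (S : {set instance n m}) : 0 < m -> swap_space S ->
  TD S (Cac 1 S) <= n * (m - 1) * m.
Proof.
move=> m_gt0 spS; apply: TD_le => N valN; pose z : 'I_m := Ordinal m_gt0.
pose g i v : outcome n m :=
  [ffun l => if (pa N i == set0) || (l \in pa N i) then v else z].
have := @TDc_le n m 1 S N (fun i => g i @: setT) set0 m spS valN.
rewrite cards0; apply=> [i|q|].
- by apply: leq_trans (leq_imset_card _ _) _; rewrite cardsT card_ord.
- by rewrite inE.
move=> N' valN' eqG _ i o.
suff [v vN vN'] : exists2 v, {in pa N i, o =1 g i v} & {in pa N' i, o =1 g i v}.
  rewrite (eq_cpt (valid_local valN) vN) (eq_cpt (valid_local valN') vN') eqG //.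
  exact: imset_f.
have [pa0|/set0Pn[j paj]] := eqVneq (pa N i) set0.
  have [pa'0|/set0Pn[j paj]] := eqVneq (pa N' i) set0.
    by exists z => j; rewrite ?pa0 ?pa'0 inE.
  exists (o j) => l; first by rewrite pa0 inE.
  move=> pal; have /card_le1_eqP/(_ j l paj pal)-> := card_pa_le i valN'.
  by rewrite ffunE pa0 eqxx.
have uniq_j l : l \in pa N i -> l = j.
  by move=> pal; have /card_le1_eqP/(_ j l paj pal) := card_pa_le i valN.
have gE v l : g i v l = if l == j then v else z.
  rewrite ffunE (_ : pa N i == set0 = false) /=.
    case: (eqVneq l j) => [->|lj]; first by rewrite paj.
    by case: ifP => // /uniq_j/eqP; rewrite (negPf lj).
  by apply/negbTE/set0Pn; exists j.
have go w : cpt N i w = cpt N i (g i (w j)).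
  by apply: eq_cpt (valid_local valN) _ => l /uniq_j->; rewrite gE eqxx.
have paj' : j \in pa N' i.
  (* The taught contexts [g i (w j)] and [g i (w' j)] differ at most in [j] and have different
     orders, so [N'] cannot lack the edge from [j]. *)
  have [w [w' [_ neq]]] := valid_nondummy valN paj.
  apply: contraNT neq => jN'; rewrite (go w) (go w') -!eqG ?imset_f //; apply/eqP.
  apply: eq_cpt (valid_local valN') _ => l pal; rewrite !gE.
  by case: eqVneq pal => // ->; rewrite (negPf jN').
exists (o j) => l; first by move/uniq_j->; rewrite gE eqxx.
move=> pal; have /card_le1_eqP/(_ j l paj' pal)-> := card_pa_le i valN'.
by rewrite gE eqxx.
Qed.

(** * Lower bound *)

Definition separable_net n m : cpnet n m := ([ffun=> set0], [ffun=> [ffun=> 1%g]]).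

Definition exception_net n m i (K : {set 'I_n.-1}) (v : {ffun 'I_n.-1 -> 'I_m})
    (t : 'I_m.-1) : cpnet n m :=
  ([ffun l => if l == i then lift i @: K else set0],
   [ffun l => [ffun o : outcome n m =>
      if (l == i) && [forall j in K, o (lift i j) == v j]
      then tperm (lo t) (hi t) else 1%g]]).

Lemma separable_net_valid n m k : valid_ac k (separable_net n m).
Proof.
apply/and5P; split.
- apply/forallP => i; apply/forallP => o; apply/forallP => o'; apply/implyP => _.
  by rewrite /cpt !ffunE.
- by apply/forallP => i; rewrite /pa ffunE inE.
- by apply/forallP => i; apply/forall_inP => j; rewrite /pa ffunE inE.
- by apply: (@rank_acyclic _ _ _ (fun=> 0)) => i j; rewrite /dep_edge /pa ffunE inE.
- by apply/forallP => i; rewrite /pa ffunE cards0.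
Qed.

Lemma tperm_lo_hi_neq1 m (t : 'I_m.-1) : tperm (lo t) (hi t) != 1%g.
Proof.
apply/eqP => /permP/(_ (lo t)); rewrite tpermL perm1 => /(congr1 val) /=; lia.
Qed.

Lemma exception_net_valid n m i (K : {set 'I_n.-1}) v (t : 'I_m.-1) :
  valid_ac #|K| (@exception_net n m i K v t).
Proof.
have paE l : pa (exception_net i K v t) l = if l == i then lift i @: K else set0.
  by rewrite /pa ffunE.
apply/and5P; split.
- apply/forallP => l; apply/forallP => o; apply/forallP => o'; apply/implyP.
  move=> /forall_inP eq_oo'; rewrite /cpt !ffunE; move: eq_oo'; rewrite paE.
  case: eqP => //= _ eq_oo'.
  suff -> : [forall j in K, o (lift i j) == v j] = [forall j in K, o' (lift i j) == v j] by [].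
  apply: eq_forallb => j; case Kj: (j \in K) => //=.
  by rewrite (eqP (eq_oo' _ (imset_f _ Kj))).
- apply/forallP => l; rewrite paE; case: eqP => [->|]; last by rewrite inE.
  by apply/imsetP => -[j _] /eqP; rewrite (negPf (neq_lift _ _)).
- apply/forallP => l; apply/forall_inP => j; rewrite paE.
  case: eqP => [->|]; last by rewrite inE.
  case/imsetP => j' Kj' ->.
  pose o := extend i (lo t) v.
  (* The index [t] supplies two distinct values, one of which differs from [v j']; setting the
     parent to it leaves the exceptional context. *)
  have [b vb] : exists b, b != v j'.
    case: (eqVneq (lo t) (v j')) => [<-|]; last by exists (lo t).
    by exists (hi t); rewrite -val_eqE /=; lia.
  apply/existsP; exists o; apply/existsP; exists (upd o (lift i j') b).
  apply/andP; split.
    by apply/forallP => l'; apply/implyP => l'j; rewrite upd_neq.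
  rewrite /cpt !ffunE eqxx /= ifT; last first.
    by apply/forall_inP => j0 _; rewrite extend_lift.
  rewrite ifF ?tperm_lo_hi_neq1 //; apply/negbTE/forall_inPn; exists j' => //.
  by rewrite updE.
- apply: (@rank_acyclic _ _ _ (fun l => l == i)) => a b; rewrite /dep_edge paE.
  case: (b == i); last by rewrite inE.
  by case/imsetP => j _ ->; rewrite eq_sym (negPf (neq_lift _ _)).
- apply/forallP => l; rewrite paE; case: ifP => _; last by rewrite cards0.
  by rewrite card_imset //; apply: lift_inj.
Qed.

(** The exchanged ranks are adjacent, so no comparison with a third value changes. *)
Lemma pref_tperm_lo_hi m (t : 'I_m.-1) a b :
  pref (tperm (lo t) (hi t)) a b != pref 1%g a b ->
  (minn a b == t :> nat) && (maxn a b == t.+1 :> nat).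
Proof.
rewrite /pref !perm1 !permE /= -!val_eqE /=.
case: (eqVneq (a : nat) t) => ea; case: (eqVneq (a : nat) t.+1) => ea';
case: (eqVneq (b : nat) t) => eb; case: (eqVneq (b : nat) t.+1) => eb' /=; lia.
Qed.

(** The minimum and maximum absorb the arbitrary orientation of the examples. *)
Definition lo_hi_swaps n m (T : {set instance n m}) i (t : 'I_m.-1) : {set instance n m} :=
  [set x in T | [&& x.1 i != x.2 i, minn (x.1 i) (x.2 i) == t
                  & maxn (x.1 i) (x.2 i) == t.+1]].

(** Dropping coordinate [i] gives both sides of a swap of [i] the same context. *)
Definition context n m (i : 'I_n) (o : outcome n m) : {ffun 'I_n.-1 -> 'I_m} :=
  [ffun j => o (lift i j)].

Lemma teaching_contexts_universal n m k (S T : {set instance n m}) i (t : 'I_m.-1) :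
  swap_space S -> teaching_set S (Cac k S) (concept S (separable_net n m)) T ->
  universal k [set context i x.1 | x in lo_hi_swaps T i t].
Proof.
move=> spS /andP[/subsetP subTS /forall_inP teachT].
apply/universalP => K cK v; pose N := exception_net i K v t.
have valN : valid_ac k N by rewrite -cK; apply: exception_net_valid.
have val0 : valid_ac k (separable_net n m) by apply: separable_net_valid.
have lohi : hi t != lo t by rewrite -val_eqE /=; lia.
have neqc : concept S N != concept S (separable_net n m).
  (* The two nets disagree on the swap of [t] and [t + 1] in the exceptional context. *)
  apply/eqP => /ffunP/(_ (oriented_swap S (i, extend i (lo t) v, (hi t, lo t)))).
  rewrite (concept_oriented_swap _ _ spS valN lohi) (concept_oriented_swap _ _ spS val0 lohi).
  rewrite /cpt !ffunE eqxx /= ifT; last first.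
    by apply/forall_inP => j _; rewrite extend_lift.
  rewrite /pref !perm1 tpermL tpermR /= ltnSn ltnNge leqnSn /=.
  by case: (_ \in S).
have := teachT _ (imset_f (concept S) (valN : N \in [pred N | valid_ac k N])).
rewrite (negPf neqc) implybF => /forall_inPn[x Tx].
have Sx := subTS x Tx; have [/forall_inP/(_ x Sx) swx _] := andP spS.
have [l xl _] := swap_upd swx.
rewrite (concept_swap spS valN Sx xl) (concept_swap spS val0 Sx xl) /cpt !ffunE.
case: (eqVneq l i) => [li|_] /=; last by rewrite eqxx.
case: ifP => [/forall_inP xv|_]; last by rewrite eqxx.
rewrite {}li /= in xl * => /pref_tperm_lo_hi mm.
exists (context i x.1); first by apply: (imset_f (fun x => context i x.1)); rewrite inE Tx xl.
by move=> j /xv/eqP; rewrite ffunE.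
Qed.

Lemma TD_ge_universal n m k (S : {set instance n m}) : swap_space S ->
  n * (m - 1) * Ucal m n k <= TD S (Cac k S).
Proof.
move=> spS; pose c0 := concept S (separable_net n m).
have c0C : c0 \in Cac k S by apply: imset_f; apply: separable_net_valid.
apply: leq_trans (leq_bigmax_cond (F := TDc S (Cac k S)) _ c0C).
have bound T : teaching_set S (Cac k S) c0 T -> n * (m - 1) * Ucal m n k <= #|T|.
  move=> tT; have [/subsetP subTS _] := andP tT.
  (* Double counting: each pair [(i, t)] needs [Ucal m n k] examples, and an example serves at most
     one pair. *)
  apply: (@leq_trans (\sum_(p : 'I_n * 'I_m.-1) \sum_(x in T) (x \in lo_hi_swaps T p.1 p.2))).
    rewrite (_ : n * (m - 1) = #|{: 'I_n * 'I_m.-1}|); last first.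
      by rewrite card_prod !card_ord subn1.
    rewrite -sum_nat_const; apply: leq_sum => -[i t] _.
    apply: leq_trans (Ucal_le (teaching_contexts_universal i t spS tT)) _.
    apply: leq_trans (leq_imset_card _ _) _; rewrite -sum1_card big_mkcond.
    rewrite [leqRHS]big_mkcond; apply: leq_sum => x _ /=.
    by rewrite inE; case: (x \in T) => //=; case: ifP.
  rewrite exchange_big -sum1_card; apply: leq_sum => x Tx /=.
  have [/forall_inP/(_ x (subTS x Tx)) swx _] := andP spS.
  rewrite (eq_bigr (fun p => if x \in lo_hi_swaps T p.1 p.2 then 1 else 0)); last first.
    by move=> p _; case: (_ \in _).
  rewrite -big_mkcond sum1_card; apply/card_le1_eqP => -[i t] [i' t'].
  move=> xit xit'; have {xit} : x \in lo_hi_swaps T i t := xit.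
  have {xit'} : x \in lo_hi_swaps T i' t' := xit'.
  rewrite !inE Tx /= => /and3P[xi' /eqP mt' _] /and3P[xi /eqP mt _].
  have ii' := swap_uniq swx xi xi'; rewrite ii' in mt *.
  by congr (_, _); apply: val_inj; rewrite /= -mt mt'.
(* The default [#|S|] of the minimum obeys the bound as well: concepts vanish outside [S], so [S] is
   a teaching set. *)
apply: bigminn_ge => //; apply: bound; apply/andP; split=> //.
apply/forall_inP => _ /imsetP[N _ ->]; apply/implyP => /forall_inP eqS.
apply/eqP/ffunP => x; have [/eqS/eqP //|/negPf NSx] := boolP (x \in S).
by rewrite !ffunE NSx.
Qed.

(** * Assembling the bounds *)

Lemma e_max_le n k : k <= n -> e_max n k <= n * k.
Proof.
move=> le_kn; rewrite /e_max -{2}(subnK le_kn) mulnDl leq_add2l bin2.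
by rewrite -divn2 (leq_trans (leq_div _ _)) // leq_mul2l leq_pred orbT.
Qed.

Theorem theorem3 (n m : nat) (S : {set instance n m}) :
  1 <= n -> 2 <= m -> swap_space S ->
  (forall k, k <= n - 1 ->
     [/\ n * (m - 1) * m ^ k <= n * (m - 1) * Ucal m n k,
         n * (m - 1) * Ucal m n k <= TD S (Cac k S),
         TD S (Cac k S) <= e_max n k + n * (m - 1) * Ucal m n k
       & e_max n k + n * (m - 1) * Ucal m n k
           <= n * k + n * (m - 1) * 'C(n - 1, k) * m ^ k]) /\
  [/\ TD S (Cac 0 S) = (m - 1) * n,
      (1 <= n - 1 -> TD S (Cac 1 S) = (m - 1) * m * n)
    & TD S (Cac (n - 1) S) = (m - 1) * n * m ^ (n - 1)].
Proof.
rewrite subn1 => n_gt0 m_gt1 spS; have m_gt0 := ltnW m_gt1.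
have chain k : k <= n.-1 ->
     [/\ n * (m - 1) * m ^ k <= n * (m - 1) * Ucal m n k,
         n * (m - 1) * Ucal m n k <= TD S (Cac k S),
         TD S (Cac k S) <= e_max n k + n * (m - 1) * Ucal m n k
       & e_max n k + n * (m - 1) * Ucal m n k
           <= n * k + n * (m - 1) * 'C(n.-1, k) * m ^ k].
  move=> le_kn; split.
  - by rewrite leq_mul2l leq_Ucal ?orbT.
  - exact: TD_ge_universal.
  - exact: TD_le_universal.
  - rewrite leq_add ?e_max_le ?(leq_trans le_kn (leq_pred n)) //.
    by rewrite -[leqRHS]mulnA leq_mul2l Ucal_leq ?orbT.
have ge k : k <= n.-1 -> n * (m - 1) * m ^ k <= TD S (Cac k S).
  by move=> /chain[le1 le2 _ _]; apply: leq_trans le1 le2.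
split=> //; split=> [|n1|]; apply/eqP; rewrite eqn_leq.
(* For [k = 0] the two ends of the chain coincide. *)
- have [_ _ le1 le2] := chain 0 (leq0n _).
  have := leq_trans le1 le2; have := ge 0 (leq0n _).
  by rewrite bin0 !muln1 muln0 mulnC => -> ->.
- by have := ge 1 n1; rewrite -mulnA mulnC => ->; rewrite mulnC mulnA TD_le_tree.
- by rewrite [_ * n]mulnC TD_le_full ?ge.
Qed.
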